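(* Let $R$ be a ring, $n\geq 1$, and $P$ a left $R$-module. The following are equivalent: (1) $P$ is $FP_n$-projective; (2) for every $n$-pure short exact sequence $0\to A\to B\to C\to 0$ of left $R$-modules with $B$ $FP_n$-injective, the map $\mathrm{Hom}_R(P,B)\to\mathrm{Hom}_R(P,C)$ is surjective. If moreover every $FP_n$-projective left $R$-module is $FP_n$-injective, then (1) and (2) are also equivalent to: (3) every $n$-pure short exact sequence $0\to A\to B\to P\to 0$ of left $R$-modules with $B$ $FP_n$-injective splits.
   Context: Rings are associative with unit; modules are left $R$-modules. For $k\geq 0$, a module $M$ is finitely $k$-presented if there is an exact sequence $F_k\to\cdots\to F_0\to M\to 0$ with each $F_i$ finitely generated free. A module $M$ is $FP_n$-injective if $\mathrm{Ext}^1_R(F,M)=0$ for every finitely $n$-presented module $F$; a module $P$ is $FP_n$-projective if $\mathrm{Ext}^1_R(P,M)=0$ for every $FP_n$-injective $M$. A short exact sequence $\mathcal S$ is $n$-pure if $\mathrm{Hom}_R(F,\mathcal S)$ is exact for every finitely $n$-presented module $F$. *)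

(* Defs.v *)
(* left R-modules are [lmodType R] over an arbitrary
   (possibly non-commutative) ring [R : pzRingType]; homomorphisms are
   [{linear M -> N}]; the finitely generated free module R^d is ['rV[R]_d]
   (scaling acts on the left, entrywise). *)
From HB Require Import structures.
From mathcomp Require Import all_boot all_order all_algebra.
Set Implicit Arguments. Unset Strict Implicit. Unset Printing Implicit Defensive.
Import GRing.Theory.
Local Open Scope ring_scope.

Section FPn.
Variable R : pzRingType.

Definition ses (A B C : lmodType R) (f : {linear A -> B}) (g : {linear B -> C}) :=
  [/\ injective f,
      (forall c, exists b, g b = c) &
      (forall b, g b = 0 <-> exists a, f a = b)].

Definition ses_splits (B C : lmodType R) (g : {linear B -> C}) :=
  exists s : {linear C -> B}, forall c, g (s c) = c.

(* Ext^1_R(F, M) = 0, via the Yoneda description of Ext^1: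
   every extension 0 -> M -> E -> F -> 0 splits. *)
Definition Ext1_zero (F M : lmodType R) :=
  forall (E : lmodType R) (f : {linear M -> E}) (g : {linear E -> F}),
    ses f g -> ses_splits g.

(* [gen_chain j M S]: the subset S of M is the image of the last map of an
   exact sequence F_j -> ... -> F_0 -> M of finitely generated free modules
   (exact at F_0, ..., F_{j-1}). *)
Fixpoint gen_chain (j : nat) : forall (M : lmodType R), (M -> Prop) -> Prop :=
  match j with
  | 0 => fun M S => exists (d : nat) (h : {linear 'rV[R]_d -> M}),
           forall v, S v <-> exists u, h u = v
  | j'.+1 => fun M S => exists (d : nat) (h : {linear 'rV[R]_d -> M}),
           (forall v, S v <-> exists u, h u = v) /\
           gen_chain j' (fun u => h u = 0)
  end.

(* M is finitely k-presented: exact F_k -> ... -> F_0 -> M -> 0 with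
   every F_i finitely generated free. *)
Definition fin_presented (k : nat) (M : lmodType R) :=
  gen_chain k (fun _ : M => True).

Definition FPn_injective (n : nat) (M : lmodType R) :=
  forall F : lmodType R, fin_presented n F -> Ext1_zero F M.

Definition FPn_projective (n : nat) (P : lmodType R) :=
  forall M : lmodType R, FPn_injective n M -> Ext1_zero P M.

Definition n_pure (n : nat) (A B C : lmodType R)
    (f : {linear A -> B}) (g : {linear B -> C}) :=
  forall F : lmodType R, fin_presented n F ->
    [/\ (forall k1 k2 : {linear F -> A},
           (forall x, f (k1 x) = f (k2 x)) -> forall x, k1 x = k2 x),
        (forall h : {linear F -> B},
           (forall x, g (h x) = 0) <->
           exists k : {linear F -> A}, forall x, f (k x) = h x) &
        (forall h : {linear F -> C},
           exists h' : {linear F -> B}, forall x, g (h' x) = h x)].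

End FPn.

(* Main.v *)
Require Import Defs.
From Stdlib Require List.
From HB Require Import structures.
From mathcomp Require Import all_boot all_order all_algebra.
From mathcomp Require Import boolp.
Import GRing.Theory.
Local Open Scope ring_scope.
Set Implicit Arguments. Unset Strict Implicit. Unset Printing Implicit Defensive.

(* Since n >= 1, a finitely n-presented module is the cokernel of some
   H : R^e -> R^d, so a countable small object argument for the inclusions
   im H -> R^d factors every map X -> Y as X -> Z -> Y, where X -> Z is an
   injection with the left lifting property against surjections with
   FP_n-injective kernel, and Z -> Y has the right lifting property against the
   inclusions.  Taking Y = 0 embeds X in an FP_n-injective module; taking X = 0
   gives a cover Q -> Y with Q FP_n-projective and FP_n-injective kernel.

   (1) => (2): n-purity and FP_n-injectivity of B make A FP_n-injective.
   (2) => (1): for an extension M -> X -> P with M FP_n-injective, embed X in an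
   FP_n-injective B; M -> B -> B/M is n-pure, and lifting P = X/M -> B/M to B
   yields a retraction of M -> X.
   (3) => (1): under the additional hypothesis the cover Q -> P is an n-pure
   extension with FP_n-injective middle term, so P is a summand of Q. *)

(** Choice for a dependent codomain: the free module attached by a cell, hence the type of the maps
    out of it, varies with the cell. *)
Lemma choice_dep (X : Type) (Y : X -> Type) (P : forall x, Y x -> Prop) :
  (forall x, exists y, P x y) -> {f : forall x, Y x & forall x, P x (f x)}.
Proof. by move=> /(_ _)/cid -/all_tag. Qed.

(** * Factoring linear maps, and maps out of free modules *)

Section LinearMaps.
Variable R : pzRingType.
Implicit Types U V W : lmodType R.

Lemma linear_ex U V (f : U -> V) : linear f ->
  exists g : {linear U -> V}, g =1 f.
Proof.
move=> lin_f.
pose g : {linear U -> V} := HB.pack f (GRing.isLinear.Build R U V _ f lin_f).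
by exists g.
Qed.

Lemma factor_inj U V W (f : {linear V -> W}) (g : {linear U -> W}) :
  injective f -> (forall x, exists y, f y = g x) ->
  exists h : {linear U -> V}, forall x, f (h x) = g x.
Proof.
move=> inj_f /choice[h hE]; have lin_h : linear h.
  by move=> a x y; apply: inj_f; rewrite linearP !hE linearP.
by have [k kE] := linear_ex lin_h; exists k => x; rewrite kE hE.
Qed.

Lemma factor_surj U V W (g : {linear U -> V}) (h : {linear U -> W}) :
  (forall y, exists x, g x = y) -> (forall x, g x = 0 -> h x = 0) ->
  exists k : {linear V -> W}, forall x, k (g x) = h x.
Proof.
move=> /choice[s sK] ker_h.
have hE x y : g x = g y -> h x = h y.
  by move=> eq_g; apply/subr0_eq; rewrite -linearB ker_h // linearB eq_g subrr.
have lin_k : linear (h \o s).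
  by move=> a x y /=; rewrite -linearP; apply: hE; rewrite linearP !sK.
by have [k kE] := linear_ex lin_k; exists k => x; rewrite kE /=; apply/hE/sK.
Qed.

Lemma row_linear_ex V d (e : 'I_d -> V) :
  exists w : {linear 'rV[R]_d -> V}, forall i, w (delta_mx 0 i) = e i.
Proof.
have lin_w : linear (fun v : 'rV[R]_d => \sum_i v 0 i *: e i).
  move=> a x y; rewrite scaler_sumr -big_split; apply: eq_bigr => i _ /=.
  by rewrite !mxE scalerDl scalerA.
have [w wE] := linear_ex lin_w; exists w => i; rewrite wE (bigD1 i) //=.
rewrite mxE !eqxx scale1r big1 ?addr0 // => j /negPf ji.
by rewrite mxE ji andbF scale0r.
Qed.

Lemma row_linear_eq V d (f g : {linear 'rV[R]_d -> V}) :
  (forall i, f (delta_mx 0 i) = g (delta_mx 0 i)) -> f =1 g.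
Proof.
move=> fg x; rewrite (row_sum_delta x) !linear_sum.
by apply: eq_bigr => i _; rewrite !linearZ fg.
Qed.

Lemma row_lift V W d (p : {linear V -> W}) (b : {linear 'rV[R]_d -> W}) :
  (forall y, exists x, p x = y) ->
  exists w : {linear 'rV[R]_d -> V}, forall x, p (w x) = b x.
Proof.
move=> surj_p.
have /choice[e eE] : forall i : 'I_d, exists x, p x = b (delta_mx 0 i) by [].
have [w wE] := row_linear_ex e; exists w.
by apply: (@row_linear_eq W d (p \o w) b) => i /=; rewrite wE.
Qed.

End LinearMaps.

(** * Kernels *)

Section KernelModule.
Variables (R : pzRingType) (U V : lmodType R) (f : {linear U -> V}).

Definition ker_pred : pred U := fun x => f x == 0.

Lemma ker_pred_submod_closed : submod_closed ker_pred.
Proof.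
split=> [|a x y]; rewrite !unfold_in /ker_pred ?linear0 //.
by move=> /eqP fx /eqP fy; rewrite linearP fx fy scaler0 addr0.
Qed.

HB.instance Definition _ :=
  GRing.isSubmodClosed.Build R U ker_pred ker_pred_submod_closed.

Definition ker_type := {x : U | ker_pred x}.
HB.instance Definition _ := [isSub of ker_type for @sval U ker_pred].
HB.instance Definition _ := [Choice of ker_type by <:].
HB.instance Definition _ := [SubChoice_isSubLmodule of ker_type by <:].

Lemma kernel_ex :
  exists (K : lmodType R) (i : {linear K -> U}), injective i /\
    forall x, f x = 0 <-> exists k, i k = x.
Proof.
exists ker_type, (val : {linear ker_type -> U}); split; first exact: val_inj.
move=> x; split=> [fx | [k <-]]; last exact/eqP/(valP k).
have fxP : ker_pred x by apply/eqP.
by exists (exist _ x fxP : ker_type).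
Qed.

End KernelModule.

(** * Quotients by a congruence *)

Section QuotientModule.
Variables (R : pzRingType) (T : Type) (e : T -> T -> Prop).
Variables (zero : T) (opp : T -> T) (add : T -> T -> T) (scale : R -> T -> T).
Hypothesis eR : forall x, e x x.
Hypothesis eS : forall x y, e x y -> e y x.
Hypothesis eT : forall x y z, e x y -> e y z -> e x z.
Hypothesis addE : forall x x' y y', e x x' -> e y y' -> e (add x y) (add x' y').
Hypothesis oppE : forall x x', e x x' -> e (opp x) (opp x').
Hypothesis scaleE : forall a x x', e x x' -> e (scale a x) (scale a x').
Hypothesis addA : forall x y z, e (add x (add y z)) (add (add x y) z).
Hypothesis addC : forall x y, e (add x y) (add y x).
Hypothesis add0 : forall x, e (add zero x) x.
Hypothesis addN : forall x, e (add (opp x) x) zero.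
Hypothesis scaleA : forall a b x, e (scale a (scale b x)) (scale (a * b) x).
Hypothesis scale1 : forall x, e (scale 1 x) x.
Hypothesis scaleDr : forall a x y,
  e (scale a (add x y)) (add (scale a x) (scale a y)).
Hypothesis scaleDl : forall x a b,
  e (scale (a + b) x) (add (scale a x) (scale b x)).

Local Open Scope quotient_scope.
(** [{classic T}] puts a classical choice structure on the arbitrary type [T], as generic quotients
    require. *)
Definition quot_rel (x y : {classic T}) := `[< e x y >].
Fact quot_rel_refl : reflexive quot_rel. Proof. by move=> x; apply/asboolP. Qed.
Fact quot_rel_sym : symmetric quot_rel.
Proof. by move=> x y; apply/asboolP/asboolP; apply: eS. Qed.
Fact quot_rel_trans : transitive quot_rel.
Proof.
by move=> y x z /asboolP xy /asboolP yz; apply/asboolP/(eT xy yz).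
Qed.
Definition quot_equiv :=
  EquivRel quot_rel quot_rel_refl quot_rel_sym quot_rel_trans.

Definition quot_mod := {eq_quot quot_equiv}.
HB.instance Definition _ := Choice.on quot_mod.

Let pi (x : T) : quot_mod := \pi_({eq_quot quot_equiv}) x.
Let rp (q : quot_mod) : T := repr (q : {eq_quot quot_equiv}).
Let piK q : pi (rp q) = q. Proof. exact: reprK. Qed.
Let piP x y : (pi x = pi y) <-> e x y.
Proof.
by split=> [/eqmodP/asboolP|/asboolP/(@eqmodP {classic T} quot_equiv)].
Qed.
Let rpE x : e (rp (pi x)) x. Proof. by apply/piP; rewrite piK. Qed.

Let q0 := pi zero.
Let qN q := pi (opp (rp q)).
Let qD p q := pi (add (rp p) (rp q)).
Let qZ a q := pi (scale a (rp q)).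
Let qNE x : qN (pi x) = pi (opp x). Proof. exact/piP/oppE. Qed.
Let qDE x y : qD (pi x) (pi y) = pi (add x y). Proof. exact/piP/addE. Qed.
Let qZE a x : qZ a (pi x) = pi (scale a x). Proof. exact/piP/scaleE. Qed.

Fact quot_addA : associative qD.
Proof.
by move=> x y z; rewrite -[x]piK -[y]piK -[z]piK !qDE; apply/piP.
Qed.
Fact quot_addC : commutative qD.
Proof. by move=> x y; rewrite -[x]piK -[y]piK !qDE; apply/piP. Qed.
Fact quot_add0 : left_id q0 qD.
Proof. by move=> x; rewrite -[x]piK qDE; apply/piP. Qed.
Fact quot_addN : left_inverse q0 qN qD.
Proof. by move=> x; rewrite -[x]piK qNE qDE; apply/piP. Qed.
HB.instance Definition _ :=
  GRing.isZmodule.Build quot_mod quot_addA quot_addC quot_add0 quot_addN.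

Fact quot_scaleA a b x : qZ a (qZ b x) = qZ (a * b) x.
Proof. by rewrite -[x]piK !qZE; apply/piP. Qed.
Fact quot_scale1 : left_id 1 qZ.
Proof. by move=> x; rewrite -[x]piK qZE; apply/piP. Qed.
Fact quot_scaleDr : right_distributive qZ +%R.
Proof.
by move=> a x y; rewrite -[x]piK -[y]piK [_ + _]qDE !qZE [RHS]qDE; apply/piP.
Qed.
Fact quot_scaleDl x : {morph qZ^~ x : a b / a + b}.
Proof. by move=> a b; rewrite -[x]piK !qZE [RHS]qDE; apply/piP. Qed.
HB.instance Definition _ := GRing.Zmodule_isLmodule.Build R quot_mod
  quot_scaleA quot_scale1 quot_scaleDr quot_scaleDl.

(** The module laws hold on [T] only up to [e], so the same quotient yields both cokernels ([T] a
    module) and modules given by generators and relations ([T] a type of formal terms). *)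
Lemma quotient_ex : exists (Q : lmodType R) (p : T -> Q),
  [/\ forall y, exists x, p x = y, forall x y, p x = p y <-> e x y,
      p zero = 0, forall x y, p (add x y) = p x + p y &
      forall a x, p (scale a x) = a *: p x].
Proof.
by exists quot_mod, pi; split=> // y; exists (rp y); apply: piK.
Qed.

End QuotientModule.

Lemma cokernel_ex (R : pzRingType) (U V : lmodType R) (h : {linear U -> V}) :
  exists (Q : lmodType R) (p : {linear V -> Q}),
    (forall y, exists x, p x = y) /\ (forall x, p x = 0 <-> exists u, h u = x).
Proof.
pose S x := exists u, h u = x.
have S0 : S 0 by exists 0; rewrite linear0.
have SZ a x : S x -> S (a *: x) by move=> [u <-]; exists (a *: u); rewrite linearZ.
have SD x y : S x -> S y -> S (x + y).
  by move=> [u <-] [v <-]; exists (u + v); rewrite linearD.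
have SN x : S x -> S (- x) by rewrite -scaleN1r; apply: SZ.
have [||||||||||||||Q [p [surj_p pP p0 pD pZ]]] :=
    @quotient_ex R V (fun x y => S (x - y)) 0 -%R +%R *:%R.
- by move=> x; rewrite subrr.
- by move=> x y /SN; rewrite opprB.
- by move=> x y z Sxy /(SD _ _ Sxy); rewrite addrA subrK.
- by move=> x x' y y' Sx Sy; rewrite opprD addrACA; apply: SD.
- by move=> x x' /SN; rewrite opprD.
- by move=> a x x' /(SZ a); rewrite scalerBr.
- by move=> x y z; rewrite (addrA x y z) subrr.
- by move=> x y; rewrite (addrC x y) subrr.
- by move=> x; rewrite add0r subrr.
- by move=> x; rewrite addNr subrr.
- by move=> a b x; rewrite scalerA subrr.
- by move=> x; rewrite scale1r subrr.
- by move=> a x y; rewrite scalerDr subrr.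
- by move=> x a b; rewrite scalerDl subrr.
have [|q qE] := @linear_ex R V Q p; first by move=> a x y; rewrite pD pZ.
exists Q, q; split=> [y|x]; first by have [x <-] := surj_p y; exists x; rewrite qE.
by rewrite qE -p0; split=> [/pP|Sx]; [rewrite subr0 | apply/pP; rewrite subr0].
Qed.

(** * Modules given by generators and relations *)

Section Presentations.
Variables (R : pzRingType) (G : Type).

Inductive term := Gen of G | Zero | Add of term & term | Scale of R & term.

Fixpoint eval (V : lmodType R) (phi : G -> V) t : V :=
  match t with
  | Gen g => phi g
  | Zero => 0
  | Add t1 t2 => eval phi t1 + eval phi t2
  | Scale a t1 => a *: eval phi t1
  end.

Lemma eval_linear (Q V : lmodType R) (h : {linear Q -> V}) (gam : G -> Q) t :
  h (eval gam t) = eval (h \o gam) t.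
Proof.
elim: t => //= [|t1 IH1 t2 IH2|a t IH]; first exact: linear0.
  by rewrite linearD IH1 IH2.
by rewrite linearZ IH.
Qed.

Lemma eq_eval (V : lmodType R) (phi psi : G -> V) t :
  phi =1 psi -> eval phi t = eval psi t.
Proof. by move=> /funext->. Qed.

Definition sat (V : lmodType R) (phi : G -> V) (E : term -> term -> Prop) :=
  forall t t', E t t' -> eval phi t = eval phi t'.

Definition seq_rel (L : seq (term * term)) t t' := List.In (t, t') L.

(* Derivations being finitary, an equation between generators can be refuted in
   a module that satisfies only finitely many of the relations. *)
Definition consequence (E : term -> term -> Prop) t t' :=
  exists L, (forall t1 t2, seq_rel L t1 t2 -> E t1 t2) /\
    forall (V : lmodType R) (phi : G -> V),
      sat phi (seq_rel L) -> eval phi t = eval phi t'.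

Lemma consequence_valid E t t' :
  (forall (V : lmodType R) (phi : G -> V), eval phi t = eval phi t') ->
  consequence E t t'.
Proof. by move=> H; exists [::]; split=> // V phi _; apply: H. Qed.

Lemma consequence_ax E t t' : E t t' -> consequence E t t'.
Proof.
move=> Ett; exists [:: (t, t')]; split=> [t1 t2 [[<- <-]|[]] // | V phi].
by apply; left.
Qed.

Lemma consequence1 E t1 t1' t t' :
  (forall (V : lmodType R) (phi : G -> V),
    eval phi t1 = eval phi t1' -> eval phi t = eval phi t') ->
  consequence E t1 t1' -> consequence E t t'.
Proof. by move=> H [L [LE LP]]; exists L; split=> // V phi sL; apply/H/LP. Qed.

Lemma consequence2 E t1 t1' t2 t2' t t' :
  (forall (V : lmodType R) (phi : G -> V), eval phi t1 = eval phi t1' ->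
    eval phi t2 = eval phi t2' -> eval phi t = eval phi t') ->
  consequence E t1 t1' -> consequence E t2 t2' -> consequence E t t'.
Proof.
move=> H [L1 [L1E L1P]] [L2 [L2E L2P]]; exists (L1 ++ L2); split.
  by move=> u u' /(List.in_app_or L1 L2)[/L1E|/L2E].
move=> V phi Hphi; apply: H.
  by apply: L1P => u u' uL; apply: Hphi; apply: (List.in_or_app L1 L2); left.
by apply: L2P => u u' uL; apply: Hphi; apply: (List.in_or_app L1 L2); right.
Qed.

Lemma consequence_sat E (V : lmodType R) (phi : G -> V) t t' :
  sat phi E -> consequence E t t' -> eval phi t = eval phi t'.
Proof. by move=> phiE [L [LE LP]]; apply: LP => u u' /LE; apply: phiE. Qed.

(** [Q] is the type of terms modulo [consequence E]. The last clause is the compactness used later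
    for injectivity: an equality in [Q] rests on finitely many relations, so it holds in every
    module satisfying just these. *)
Lemma presentation_ex (E : term -> term -> Prop) :
  exists (Q : lmodType R) (gam : G -> Q),
  [/\ forall q, exists t, eval gam t = q,
      sat gam E,
      (forall (V : lmodType R) (phi : G -> V), sat phi E ->
        exists h : {linear Q -> V}, forall g, h (gam g) = phi g) &
      forall t t', eval gam t = eval gam t' -> consequence E t t'].
Proof.
have [||||||||||||||Q [p [surj_p pP p0 pD pZ]]] :=
    @quotient_ex R term (consequence E) Zero (Scale (-1)) Add Scale.
- by move=> x; apply: consequence_valid.
- by move=> x y; apply: consequence1.
- by move=> x y z; apply: consequence2 => V phi -> ->.
- by move=> x x' y y'; apply: consequence2 => V phi /= -> ->.
- by move=> x x'; apply: consequence1 => V phi /= ->.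
- by move=> a x x'; apply: consequence1 => V phi /= ->.
- by move=> x y z; apply: consequence_valid => V phi /=; rewrite addrA.
- by move=> x y; apply: consequence_valid => V phi /=; rewrite addrC.
- by move=> x; apply: consequence_valid => V phi /=; rewrite add0r.
- by move=> x; apply: consequence_valid => V phi /=; rewrite scaleN1r addNr.
- by move=> a b x; apply: consequence_valid => V phi /=; rewrite scalerA.
- by move=> x; apply: consequence_valid => V phi /=; rewrite scale1r.
- by move=> a x y; apply: consequence_valid => V phi /=; rewrite scalerDr.
- by move=> x a b; apply: consequence_valid => V phi /=; rewrite scalerDl.
pose gam g := p (Gen g); exists Q, gam.
have evalE t : eval gam t = p t.
  by elim: t => //= [t1 -> t2 ->|a t ->]; rewrite (pD, pZ).
have sP t t' : eval gam t = eval gam t' -> consequence E t t'.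
  by rewrite !evalE => /pP.
split=> // [q|t t' Ett|V phi phiE].
- by have [t <-] := surj_p q; exists t.
- by rewrite !evalE; apply/pP/consequence_ax.
(* The universal map evaluates a chosen representing term; by [sE] the choice does not matter. *)
have /choice[s sK] := surj_p.
have sE q t : p t = q -> eval phi (s q) = eval phi t.
  by rewrite -(sK q) => /esym/pP/(consequence_sat phiE); rewrite sK.
have [|h hE] := @linear_ex R Q V (eval phi \o s).
  by move=> a x y /=; rewrite (sE _ (Add (Scale a (s x)) (s y))) // pD pZ !sK.
by exists h => g; rewrite hE /= (sE _ (Gen g)).
Qed.

End Presentations.
Arguments Zero {R G}.

(** * Splittings, pullbacks and pushouts *)

Section ShortExact.
Variable R : pzRingType.
Implicit Types A B C D E F M P V : lmodType R.

Lemma retraction_of_section A B C (f : {linear A -> B}) (g : {linear B -> C}) :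
  ses f g -> ses_splits g -> exists r : {linear B -> A}, forall x, r (f x) = x.
Proof.
move=> [inj_f _ ker_g] [s sK].
have [b|r rE] := factor_inj (g := idfun \- (s \o g)) inj_f.
  by apply/ker_g; rewrite /= linearB sK subrr.
exists r => x; apply: inj_f; rewrite rE /=.
by have /ker_g -> : exists a, f a = f x; [exists x | rewrite linear0 subr0].
Qed.

Lemma section_of_retraction A B C (f : {linear A -> B}) (g : {linear B -> C})
    (r : {linear B -> A}) :
  ses f g -> (forall x, r (f x) = x) -> ses_splits g.
Proof.
move=> [_ surj_g ker_g] rK.
have [b|s sE] := factor_surj (h := idfun \- (f \o r)) surj_g.
  by move=> /ker_g[x <-] /=; rewrite rK subrr.
exists s => c; have [b <-] := surj_g c; rewrite sE /= linearB.
have /ker_g -> : exists a, f a = f (r b) by exists (r b).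
by rewrite subr0.
Qed.

Lemma pullback_ex A B C (g : {linear B -> C}) (h : {linear A -> C}) :
  exists (E : lmodType R) (p : {linear E -> B}) (q : {linear E -> A}),
    [/\ forall x, g (p x) = h (q x),
        forall x y, p x = p y -> q x = q y -> x = y,
        forall b a, g b = h a -> exists x, p x = b /\ q x = a &
        forall D (b : {linear D -> B}) (a : {linear D -> A}),
          (forall x, g (b x) = h (a x)) -> exists k : {linear D -> E},
            (forall x, p (k x) = b x) /\ (forall x, q (k x) = a x)].
Proof.
have [E [i [inj_i ker_i]]] :=
  kernel_ex ((g \o fst) \- (h \o snd) : {linear (B * A)%type -> C}).
exists E, (fst \o i), (snd \o i); split=> /= [x|x y p_eq q_eq|b a gh|D b a gh].
- by apply/subr0_eq/(ker_i (i x)); exists x.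
- by apply: inj_i; rewrite [i x]surjective_pairing p_eq q_eq -surjective_pairing.
- have /(ker_i (b, a))[x xE] : g b - h a = 0 by rewrite gh subrr.
  by exists x; rewrite xE.
have [|ba baE] := @linear_ex R D (B * A)%type (fun x => (b x, a x)).
  by move=> c x y; rewrite !linearP.
have [x|k kE] := factor_inj (g := ba) inj_i.
  by apply/ker_i; rewrite baE /= gh subrr.
by exists k; split=> x; rewrite kE baE.
Qed.

(** Pulling the sequence back along [h] gives an extension of [F] by [A]; a section of it, followed
    by the projection to [B], is the lift. *)
Lemma Ext1_zero_lift A B C F (f : {linear A -> B}) (g : {linear B -> C})
    (h : {linear F -> C}) :
  ses f g -> Ext1_zero F A ->
  exists h' : {linear F -> B}, forall x, g (h' x) = h x.
Proof.
move=> [inj_f surj_g ker_g] ext0.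
have [E [p [q [pq pq_inj pq_ex pq_map]]]] := pullback_ex g h.
have [x|j [pj qj]] := pq_map A f (\0 : {linear A -> F}).
  by rewrite /= linear0; apply/ker_g; exists x.
have [|s sK] := ext0 E j q; last first.
  by exists (p \o s) => x /=; rewrite pq sK.
split=> [x y jxy|c|y]; first by apply: inj_f; rewrite -pj jxy pj.
  by have [b /pq_ex[y [_ <-]]] := surj_g (h c); exists y.
split=> [qy|[x <-]]; last by rewrite qj.
have /ker_g[x xE] : g (p y) = 0 by rewrite pq qy linear0.
by exists x; apply: pq_inj; rewrite (pj, qj).
Qed.

(** [V'] is the pushout of [V] and [D] over [E]. Although [H] may fail to be injective, the
    hypothesis lets [u] factor through im H, so [V'] is also the pushout along the inclusion of im H
    in [D]; hence [j] is injective with cokernel D / im H. *)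
Lemma attach_ex D E V (H : {linear E -> D}) (u : {linear E -> V}) :
  (forall x, H x = 0 -> u x = 0) ->
  exists (V' F : lmodType R) (j : {linear V -> V'}) (w : {linear D -> V'})
      (p : {linear V' -> F}),
  [/\ ses j p, forall x, w (H x) = j (u x), forall c, exists v, p (w v) = c &
      forall v, p (w v) = 0 <-> exists x, H x = v].
Proof.
move=> ker_Hu.
have [F [g [surj_g ker_g]]] := cokernel_ex H.
have [|uH uHE] := @linear_ex R E (V * D)%type (fun x => (- u x, H x)).
  by move=> a x y; rewrite !linearP.
have [V' [pi [surj_pi ker_pi]]] := cokernel_ex uH.
have [j jE] : exists j : {linear V -> V'}, j =1 (fun x => pi (x, 0)).
  apply: linear_ex => a x y; rewrite -linearP; congr (pi (_, _)).
  by rewrite /= scaler0 addr0.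
have [w wE] : exists w : {linear D -> V'}, w =1 (fun v => pi (0, v)).
  apply: linear_ex => a x y; rewrite -linearP; congr (pi (_, _)).
  by rewrite /= scaler0 addr0.
have [z|p pE] := factor_surj (h := g \o snd) surj_pi.
  by move=> /ker_pi[x <-]; apply/ker_g; exists x; rewrite uHE.
exists V', F, j, w, p; split.
- split=> [x y|c|b].
  + rewrite !jE => /eqP; rewrite -subr_eq0 -linearB => /eqP/ker_pi[t].
    rewrite uHE => -[xE]; rewrite subrr => /ker_Hu tE; apply/subr0_eq.
    by rewrite -[LHS]/(x - y) -xE tE oppr0.
  + by have [v <-] := surj_g c; exists (pi (0, v)); rewrite pE.
  + split=> [|[x <-]]; last by rewrite jE pE /= linear0.
    (* If v = H t, then (x, v) and (x + u t, 0) have the same class. *)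
    have [[x v] <-] := surj_pi b; rewrite pE /= => /ker_g[t <-].
    exists (x + u t); rewrite jE; apply/subr0_eq; rewrite -linearB.
    apply/ker_pi; exists (- t); rewrite uHE !linearN opprK.
    by congr pair; rewrite ?sub0r // addrAC subrr add0r.
- move=> x; rewrite wE jE; apply/subr0_eq; rewrite -linearB.
  by apply/ker_pi; exists x; rewrite uHE; congr pair; rewrite (sub0r, subr0).
- by move=> c; have [v <-] := surj_g c; exists v; rewrite wE pE.
- by move=> v; rewrite wE pE /=; apply: ker_g.
Qed.

End ShortExact.

(** * Lifting properties against presenting maps *)

Section Cells.
Variables (R : pzRingType) (n : nat).
Implicit Types A B C E F K M P Q V X Y Z : lmodType R.

(* For such [H], the cokernel of [H] is finitely (n+1)-presented, and every
   finitely (n+1)-presented module arises in this way. *)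
Definition presenting e d (H : {linear 'rV[R]_e -> 'rV[R]_d}) :=
  gen_chain n (fun v => exists w, H w = v).

Lemma coker_fin_presented e d (H : {linear 'rV[R]_e -> 'rV[R]_d}) F
    (g : {linear 'rV[R]_d -> F}) :
  presenting H -> (forall y, exists x, g x = y) ->
  (forall v, g v = 0 <-> exists w, H w = v) -> fin_presented n.+1 F.
Proof.
move=> presH surj_g ker_g; exists d, g; split=> [v|]; first by split.
suff -> : (fun v => g v = 0) = (fun v => exists w, H w = v) by [].
by apply/funext => v; apply/propext.
Qed.

Lemma fin_presented_coker F : fin_presented n.+1 F ->
  exists e d (H : {linear 'rV[R]_e -> 'rV[R]_d}) (g : {linear 'rV[R]_d -> F}),
  [/\ presenting H, forall y, exists x, g x = y &
      forall v, g v = 0 <-> exists w, H w = v].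
Proof.
move=> [d [g [surj_g chain]]].
(* The index n+1 provides at least one map of the chain beyond [g]; the case split on [n] only
   unfolds [gen_chain]. *)
have [e [H HE]] : exists e (H : {linear 'rV[R]_e -> 'rV[R]_d}),
    forall v, g v = 0 <-> exists w, H w = v.
  by case: n chain => [|m] [e [H]]; [|case]; exists e, H.
exists e, d, H, g; split=> // [|y]; last exact/surj_g.
rewrite /presenting.
suff <- : (fun v => g v = 0) = (fun v => exists w, H w = v) by [].
by apply/funext => v; apply/propext.
Qed.

(** Such a [u] amounts to a map im H -> M, so this is injectivity of [M] relative to the inclusion
    of im H in R^d. *)
Definition extends_along e d (H : {linear 'rV[R]_e -> 'rV[R]_d}) M :=
  forall u : {linear 'rV[R]_e -> M}, (forall x, H x = 0 -> u x = 0) ->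
  exists w : {linear 'rV[R]_d -> M}, forall x, w (H x) = u x.

(** Since R^d is projective, Ext^1(coker H, M) is the obstruction to extending maps im H -> M to
    R^d. Pushing out along [u] gives one direction; for the other, a lift R^d -> E is corrected
    until it vanishes on im H. *)
Lemma FPn_injectiveP M : FPn_injective n.+1 M <->
  forall e d (H : {linear 'rV[R]_e -> 'rV[R]_d}),
    presenting H -> extends_along H M.
Proof.
split=> [inj_M e d H presH u ker_Hu | ext_M F /fin_presented_coker].
  have [V [F [j [w [p [ses_jp wE surj_pw ker_pw]]]]]] := attach_ex ker_Hu.
  have presF : fin_presented n.+1 F.
    exact: (@coker_fin_presented _ _ H F (p \o w)).
  have [r rK] := retraction_of_section ses_jp (inj_M F presF _ _ _ ses_jp).
  by exists (r \o w) => x /=; rewrite wE rK.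
move=> [e [d [H [g [presH surj_g ker_g]]]]] E f p [inj_f surj_p ker_p].
have [w wE] := row_lift g surj_p.
have [x|u uE] := factor_inj (g := w \o H) inj_f.
  by apply/ker_p; rewrite /= wE; apply/ker_g; exists x.
have [x Hx0|v vE] := ext_M _ _ H presH u.
  by apply: inj_f; rewrite uE /= Hx0 !linear0.
have [_ /ker_g[x <-]|s sE] := factor_surj (h := w \- (f \o v)) surj_g.
  by rewrite /= vE uE subrr.
exists s => c; have [y <-] := surj_g c; rewrite sE /= linearB wE.
have /ker_p -> : exists a, f a = f (v y) by exists (v y).
by rewrite subr0.
Qed.

Definition left_lifting X Z (i : {linear X -> Z}) :=
  forall M E Y (f : {linear M -> E}) (p : {linear E -> Y}),
    FPn_injective n.+1 M -> ses f p ->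
    forall (a : {linear X -> E}) (b : {linear Z -> Y}),
    (forall x, p (a x) = b (i x)) ->
  exists c : {linear Z -> E}, (forall x, c (i x) = a x) /\
    (forall z, p (c z) = b z).

(** Freeness lifts [b] to some [w]; the error a - wH lands in [M], extends to R^d by
    FP_n-injectivity, and is added back to [w]. *)
Lemma cell_lift e d (H : {linear 'rV[R]_e -> 'rV[R]_d}) M E Y
    (f : {linear M -> E}) (p : {linear E -> Y})
    (a : {linear 'rV[R]_e -> E}) (b : {linear 'rV[R]_d -> Y}) :
  presenting H -> FPn_injective n.+1 M -> ses f p ->
  (forall x, H x = 0 -> a x = 0) -> (forall x, p (a x) = b (H x)) ->
  exists c : {linear 'rV[R]_d -> E}, (forall x, c (H x) = a x) /\
    (forall z, p (c z) = b z).
Proof.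
move=> presH /FPn_injectiveP ext_M [inj_f surj_p ker_p] ker_Ha paE.
have [w wE] := row_lift b surj_p.
have [x|u uE] := factor_inj (g := a \- (w \o H)) inj_f.
  by apply/ker_p; rewrite /= linearB wE paE subrr.
have [x Hx0|v vE] := ext_M _ _ H presH u.
  by apply: inj_f; rewrite uE /= Hx0 ker_Ha // !linear0 addr0.
exists (w \+ (f \o v)); split=> x /=; first by rewrite vE uE /= addrC subrK.
rewrite linearD wE; have /ker_p -> : exists t, f t = f (v x) by exists (v x).
by rewrite addr0.
Qed.

Definition right_lifting Z Y (q : {linear Z -> Y}) :=
  forall e d (H : {linear 'rV[R]_e -> 'rV[R]_d}), presenting H ->
  forall (u : {linear 'rV[R]_e -> Z}) (v : {linear 'rV[R]_d -> Y}),
    (forall x, H x = 0 -> u x = 0) -> (forall x, q (u x) = v (H x)) ->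
  exists w : {linear 'rV[R]_d -> Z}, (forall x, w (H x) = u x) /\
    (forall z, q (w z) = v z).

(** This is the cell 0 -> R: solving lifting problems against it means hitting every element of the
    target. All further terms of the chain are 0. *)
Lemma presenting0 : presenting (\0 : {linear 'rV[R]_0 -> 'rV[R]_1}).
Proof.
suff H m d : gen_chain m (fun v : 'rV[R]_d => exists w : 'rV[R]_0, \0 w = v).
  exact: H.
elim: m d => [|m IH] d; first by exists 0%N, \0.
exists 0%N, \0; split=> //.
suff <- : (fun v : 'rV[R]_0 => exists w : 'rV[R]_0, \0 w = v) =
   (fun u => (\0 : {linear 'rV[R]_0 -> 'rV[R]_d}) u = 0) by [].
apply/funext => v; apply/propext; split=> // _.
by exists 0; apply/rowP => -[].
Qed.

Lemma right_lifting_surj Z Y (q : {linear Z -> Y}) :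
  right_lifting q -> forall y, exists z, q z = y.
Proof.
move=> rl_q y.
have [v vE] := row_linear_ex (fun _ : 'I_1 => y).
have [//||w [_ qw]] := rl_q _ _ _ presenting0 \0 v.
  by move=> x; rewrite /= !linear0.
by exists (w (delta_mx 0 0)); rewrite qw vE.
Qed.

(** A lifting problem with zero bottom map has its solution in the kernel, so it is an extension
    problem for [K]. *)
Lemma right_lifting_ker K Z Y (i : {linear K -> Z}) (q : {linear Z -> Y}) :
  right_lifting q -> injective i -> (forall z, q z = 0 <-> exists k, i k = z) ->
  FPn_injective n.+1 K.
Proof.
move=> rl_q inj_i ker_q; apply/FPn_injectiveP => e d H presH u ker_Hu.
have [x Hx0|x|w [wE qw]] := rl_q _ _ H presH (i \o u) \0.
- by rewrite /= ker_Hu ?linear0.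
- by apply/ker_q; exists (u x).
have [x|v vE] := factor_inj (g := w) inj_i; first by apply/ker_q; rewrite qw.
by exists v => x; apply: inj_i; rewrite vE wE.
Qed.

End Cells.

(** * Colimits of sequences of injections *)

Section Colimit.
Variables (R : pzRingType) (Z : nat -> lmodType R).
Variable inc : forall k, {linear Z k -> Z k.+1}.
Hypothesis inj_inc : forall k, injective (inc k).

(* The zero map if [l < k]. *)
Fixpoint transition k l : {linear Z k -> Z l} :=
  match k =P l with
  | ReflectT e => ecast i {linear Z k -> Z i} e idfun
  | ReflectF _ =>
    match l return {linear Z k -> Z l} with
    | 0 => \0
    | l'.+1 => inc l' \o transition k l'
    end
  end.

Lemma transition_id k x : transition k k x = x.
Proof.
case: k x => [|k] x /=; case: eqP => // e; by rewrite (eq_irrelevance e erefl).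
Qed.

Lemma transitionS k l x : (k <= l)%N ->
  transition k l.+1 x = inc l (transition k l x).
Proof. by move=> kl /=; case: eqP => // e; rewrite e ltnn in kl. Qed.

Lemma transition_inj k l : (k <= l)%N -> injective (transition k l).
Proof.
elim: l => [|l IH]; first by case: k => // _ x y; rewrite !transition_id.
rewrite leq_eqVlt => /predU1P[eq_kl|/ltnSE kl] x y.
  by subst k; rewrite !transition_id.
by rewrite !transitionS // => /inj_inc/(IH kl).
Qed.

Lemma transition_inc k l x : (k < l)%N ->
  transition k.+1 l (inc k x) = transition k l x.
Proof.
elim: l => // l IH; rewrite ltnS leq_eqVlt => /predU1P[eq_kl|kl].
  by subst l; rewrite transition_id transitionS ?transition_id.
by rewrite !transitionS ?IH // ltnW.
Qed.

Let gen := {k & Z k}.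
Let elt k (x : Z k) : gen := existT _ k x.

Inductive colimit_eq : term R gen -> term R gen -> Prop :=
| ColimLinear k a (x y : Z k) : colimit_eq (Gen R (elt (a *: x + y)))
    (Add (Scale a (Gen R (elt x))) (Gen R (elt y)))
| ColimInc k (x : Z k) : colimit_eq (Gen R (elt (inc k x))) (Gen R (elt x)).

Let to_stage l (g : gen) : Z l := transition (projT1 g) l (projT2 g).

(** Finitely many relations involve finitely many stages, so every late enough stage is a model of
    them. This makes the maps into the colimit injective. *)
Lemma to_stage_sat L :
  (forall t t', seq_rel L t t' -> colimit_eq t t') ->
  exists N, forall l, (N <= l)%N -> sat (@to_stage l) (seq_rel L).
Proof.
elim: L => [|[t t'] L IH] LE; first by exists 0%N => l _ ? ?; case.
have [|N NP] := IH; first by move=> u u' uL; apply: LE; right.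
have [M MP] : exists M, forall l, (M <= l)%N ->
    eval (@to_stage l) t = eval (@to_stage l) t'.
  have /LE[k a x y|k x] : seq_rel ((t, t') :: L) t t' by left.
    by exists 0%N => l _; rewrite /= /to_stage /= linearP.
  (* The bound is k+1: at stage k the left side is sent to the default value 0 and the right side to
     [x]. *)
  by exists k.+1 => l kl; rewrite /= /to_stage /= transition_inc.
exists (maxn M N) => l; rewrite geq_max => /andP[Ml Nl] u u' [[<- <-]|uL].
  exact: MP.
exact: NP.
Qed.

Lemma colimit_ex : exists (C : lmodType R) (j : forall k, {linear Z k -> C}),
  [/\ forall k, injective (j k),
      forall k x, j k.+1 (inc k x) = j k x,
      forall k l x, (k <= l)%N -> exists y, j l y = j k x,
      forall c, exists k x, j k x = c &
      forall (V : lmodType R) (phi : forall k, {linear Z k -> V}),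
        (forall k x, phi k.+1 (inc k x) = phi k x) ->
        exists h : {linear C -> V}, forall k x, h (j k x) = phi k x].
Proof.
have [C [gam [surj_gam sat_gam univ_gam inj_gam]]] := presentation_ex colimit_eq.
have j_ex k : exists j : {linear Z k -> C}, j =1 (fun x => gam (elt x)).
  by apply: linear_ex => a x y; have := sat_gam _ _ (ColimLinear a x y).
pose j k := sval (cid (j_ex k)).
have jE k x : j k x = gam (elt x) by rewrite /j; case: cid.
have j_inc k x : j k.+1 (inc k x) = j k x.
  by rewrite !jE; have := sat_gam _ _ (ColimInc x).
have j_up k l x : (k <= l)%N -> exists y, j l y = j k x.
  elim: l => [|l IH]; first by case: k x => // x _; exists x.
  rewrite leq_eqVlt => /predU1P[kl|/ltnSE/IH[y yE]]; last first.
    by exists (inc l y); rewrite j_inc.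
  by subst k; exists x.
exists C, j; split=> // [k x y|c|V phi phiE].
- rewrite !jE => /(inj_gam (Gen R (elt x)) (Gen R (elt y))).
  (* The equality already holds at stage max(k, N), where [transition] is injective. *)
  move=> [L [/to_stage_sat[N NP] /(_ _ _ (NP _ (leq_maxr k N)))]].
  by apply: transition_inj; apply: leq_maxl.
- have [t <-] := surj_gam c.
  elim: t => /= [[k x]||t1 [k1 [x1 <-]] t2 [k2 [x2 <-]]|a t [k [x <-]]].
  + by exists k, x; rewrite jE.
  + by exists 0%N, 0; rewrite linear0.
  + have [y1 <-] := j_up _ _ x1 (leq_maxl k1 k2).
    have [y2 <-] := j_up _ _ x2 (leq_maxr k1 k2).
    by exists (maxn k1 k2), (y1 + y2); rewrite linearD.
  + by exists k, (a *: x); rewrite linearZ.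
have [|h hE] := univ_gam V (fun g => phi (projT1 g) (projT2 g)).
  by move=> _ _ [k a x y|k x] /=; rewrite (linearP, phiE).
by exists h => k x; rewrite jE hE.
Qed.

End Colimit.

(** * One step of the small object argument *)

Section Step.
Variables (R : pzRingType) (n : nat) (Y : lmodType R).

Record over := Over { tot :> lmodType R; str : {linear tot -> Y} }.

(* A lifting problem of a presenting map against [str X], to be solved after
   one step. *)
Record cell (X : over) := Cell {
  cell_e : nat;
  cell_d : nat;
  cell_H : {linear 'rV[R]_cell_e -> 'rV[R]_cell_d};
  cell_u : {linear 'rV[R]_cell_e -> X};
  cell_v : {linear 'rV[R]_cell_d -> Y};
  cell_presenting : presenting n cell_H;
  cell_ker : forall x, cell_H x = 0 -> cell_u x = 0;
  cell_comm : forall x, str X (cell_u x) = cell_v (cell_H x)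
}.

Variable X : over.

Let gen := (X + {c : cell X & 'rV[R]_(cell_d c)})%type.
Let base x : term R gen := Gen R (inl x).
Let incell (c : cell X) v : term R gen := Gen R (inr (existT _ c v)).

(** These relations present the pushout that attaches to [X] all cells simultaneously, each R^d
    being glued along im H. *)
Inductive step_eq : term R gen -> term R gen -> Prop :=
| StepBase a x y : step_eq (base (a *: x + y)) (Add (Scale a (base x)) (base y))
| StepCell c a v w :
    step_eq (@incell c (a *: v + w)) (Add (Scale a (@incell c v)) (@incell c w))
| StepGlue c x : step_eq (@incell c (cell_H c x)) (base (cell_u c x)).

Let step_map (V : lmodType R) (i : {linear X -> V})
    (w : forall c : cell X, {linear 'rV[R]_(cell_d c) -> V}) (g : gen) : V :=
  match g with inl x => i x | inr s => w (projT1 s) (projT2 s) end.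

Let glued (V : lmodType R) (i : {linear X -> V})
    (c : cell X) (w : {linear 'rV[R]_(cell_d c) -> V}) :=
  forall x, w (cell_H c x) = i (cell_u c x).

Lemma step_map_sat (V : lmodType R) (i : {linear X -> V}) w :
  (forall c, glued i (w c)) -> sat (step_map i w) step_eq.
Proof. by move=> glue _ _ [a x y|c a v v'|c x] /=; rewrite (linearP, glue). Qed.

(** A finite list of relations mentions finitely many cells, and gluing matters only for those. *)
Lemma step_map_seq_sat L :
  (forall t t', seq_rel L t t' -> step_eq t t') ->
  exists cs : seq (cell X), forall (V : lmodType R) (i : {linear X -> V}) w,
    (forall c, List.In c cs -> glued i (w c)) -> sat (step_map i w) (seq_rel L).
Proof.
elim: L => [|[t t'] L IH] LE; first by exists [::] => V i w _ ? ?; case.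
have [|cs csP] := IH; first by move=> u u' uL; apply: LE; right.
have [cs' csP'] : exists cs' : seq (cell X),
    forall (V : lmodType R) (i : {linear X -> V}) w,
    (forall c, List.In c cs' -> glued i (w c)) ->
    eval (step_map i w) t = eval (step_map i w) t'.
  have /LE[a x y|c a v v'|c x] : seq_rel ((t, t') :: L) t t' by left.
  - by exists [::] => V i w _ /=; rewrite linearP.
  - by exists [::] => V i w _ /=; rewrite linearP.
  - by exists [:: c] => V i w glue /=; rewrite glue //; left.
exists (cs' ++ cs) => V i w glue u u' [[<- <-]|uL].
  by apply: csP' => c cc; apply/glue/(List.in_or_app cs' cs); left.
by apply: csP => // c cc; apply/glue/(List.in_or_app cs' cs); right.
Qed.

(** Attaching one cell at a time keeps [X] embedded. The result is the test module in which an
    equality derived from finitely many relations can be refuted. *)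
Lemma attach_seq_ex (cs : seq (cell X)) :
  exists (V : lmodType R) (i : {linear X -> V}), injective i /\
    forall c, List.In c cs ->
      exists w : {linear 'rV[R]_(cell_d c) -> V}, glued i w.
Proof.
elim: cs => [|c cs [V [i [inj_i iP]]]]; first by exists X, idfun; split=> // ? [].
have [x /cell_ker ux0|V' [_ [j [w [_ [[inj_j _ _] wE _ _]]]]]] :=
  @attach_ex R _ _ V (cell_H c) (i \o cell_u c).
  by rewrite /= ux0 linear0.
exists V', (j \o i); split=> [x y /inj_j/inj_i // | c' [<-|/iP[w' w'E]]].
  by exists w.
by exists (j \o w') => x /=; rewrite w'E.
Qed.

Lemma step_ex : exists (X' : over) (i : {linear X -> X'}),
  [/\ injective i, forall x, str X' (i x) = str X x, left_lifting n i &
      forall c : cell X, exists w : {linear 'rV[R]_(cell_d c) -> X'},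
        (forall x, w (cell_H c x) = i (cell_u c x)) /\
        (forall z, str X' (w z) = cell_v c z)].
Proof.
have [Q [gam [surj_gam sat_gam univ_gam inj_gam]]] := presentation_ex step_eq.
have [i iE] : exists i : {linear X -> Q}, i =1 (fun x => gam (inl x)).
  by apply: linear_ex => a x y; have := sat_gam _ _ (StepBase a x y).
have /choice_dep[w wE] : forall c, exists w : {linear 'rV[R]_(cell_d c) -> Q},
    forall v, w v = gam (inr (existT _ c v)).
  by move=> c; apply: linear_ex => a x y; have := sat_gam _ _ (@StepCell c a x y).
have w_glue c x : w c (cell_H c x) = i (cell_u c x).
  by rewrite wE iE; have := sat_gam _ _ (@StepGlue c x).
have [|q qE] := univ_gam Y (step_map (str X) (@cell_v X)).
  by apply: step_map_sat => c x; rewrite cell_comm.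
exists (Over q), i; split=> [x y|x|M E W f p inj_M ses_fp a b paE|c].
- rewrite !iE => /(inj_gam (base x) (base y)).
  move=> [L [/step_map_seq_sat[cs csP] LP]].
  have [V [k [inj_k kP]]] := attach_seq_ex cs.
  (* Cells outside [cs] are sent to [V] by the zero map, as their gluing relations do not occur in
     [L]. *)
  have /choice_dep[v vE] : forall c, exists v : {linear 'rV[R]_(cell_d c) -> V},
      List.In c cs -> glued k v.
    move=> c; have [/kP[v vE]|nc] := EM (List.In c cs); first by exists v.
    by exists \0.
  by apply/inj_k/(LP _ (step_map k v))/csP.
- by rewrite iE qE.
(* The lifting is solved cell by cell and the solutions are glued by the universal property; p h = b
   is then checked on generators. *)
- have /choice_dep[e eE] : forall c, exists e : {linear 'rV[R]_(cell_d c) -> E},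
      (forall x, e (cell_H c x) = a (cell_u c x)) /\
      (forall z, p (e z) = b (w c z)).
    move=> c; apply: (cell_lift (a := a \o cell_u c) (b := b \o w c)
      (cell_presenting c) inj_M ses_fp) => x /=.
      by move/cell_ker => ->; rewrite linear0.
    by rewrite paE w_glue.
  have [|h hE] := univ_gam E (step_map a e).
    by apply: step_map_sat => c; case: (eE c).
  exists h; split=> [x|z]; first by rewrite iE hE.
  have [t <-] := surj_gam z.
  rewrite -[LHS]/((p \o h) (eval gam t)) !eval_linear; apply: eq_eval.
  by move=> [x|[c v]] /=; rewrite hE /= ?paE ?iE // (eE c).2 wE.
- exists (w c); split=> // z /=; by rewrite wE qE.
Qed.

End Step.

(** * The factorization of a map *)

Section Factorization.
Variables (R : pzRingType) (n : nat).

(** The step is iterated countably often and the colimit taken. Left lifting passes through the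
    stages by recursion; for right lifting, countably many stages suffice because the sources R^e
    are finitely generated. *)
Lemma factorization_ex (X Y : lmodType R) (f : {linear X -> Y}) :
  exists (Z : lmodType R) (i : {linear X -> Z}) (q : {linear Z -> Y}),
    [/\ injective i, forall x, q (i x) = f x, left_lifting n i &
        right_lifting n q].
Proof.
have [step /choice_dep[inc stepP]] := choice (@step_ex R n Y).
pose T := fix T k := if k is k'.+1 then step (T k') else Over f.
pose incT k : {linear T k -> T k.+1} := inc (T k).
have inj_incT k : injective (incT k) by case: (stepP (T k)).
have strT k x : str (T k.+1) (incT k x) = str (T k) x by case: (stepP (T k)).
have [Z [j [inj_j j_inc j_up surj_j univ_j]]] := colimit_ex inj_incT.
have [q qE] := univ_j Y (fun k => str (T k)) strT.
exists Z, (j 0%N), q; split; first exact: (inj_j 0%N).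
- exact: (qE 0%N).
- move=> M E W g p inj_M ses_gp a b paE.
  (* Each partial lift carries its compatibility with [b], which the next extension needs. *)
  pose lifts k (c : {linear T k -> E}) := forall x, p (c x) = b (j k x).
  have lift_next k (c : {c : {linear T k -> E} | lifts k c}) :
      {c' : {c' : {linear T k.+1 -> E} | lifts k.+1 c'} |
        forall x, sval c' (incT k x) = sval c x}.
    apply: cid; case: c => c cE /=.
    have [_ _ /(_ M E W g p inj_M ses_gp c (b \o j k.+1)) lift _] := stepP (T k).
    have [x|c' [c'E pc']] := lift; first by rewrite cE /= j_inc.
    by exists (exist _ c' pc').
  pose c := fix c k : {c : {linear T k -> E} | lifts k c} :=
    if k is k'.+1 then sval (lift_next k' (c k')) else exist (lifts 0%N) a paE.
  have [|h hE] := univ_j E (fun k => sval (c k)).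
    by move=> k x; apply: (svalP (lift_next k (c k))).
  exists h; split=> [x|z]; first exact: (hE 0%N).
  by have [k [x <-]] := surj_j z; rewrite hE (svalP (c k)).
move=> e d H presH u v ker_Hu quE.
(* Finite generation of the source of [u] makes it factor through a stage. *)
have /choice[k kP] : forall i : 'I_e, exists k, exists x, j k x = u (delta_mx 0 i).
  by move=> i; have [k [x xE]] := surj_j (u (delta_mx 0 i)); exists k, x.
pose K := \max_i k i.
have /choice[y yE] : forall i : 'I_e, exists y, j K y = u (delta_mx 0 i).
  by move=> i; have [x <-] := kP i; apply/j_up/leq_bigmax.
have [t tE] := row_linear_ex y.
have jt : forall x, j K (t x) = u x.
  by apply: (@row_linear_eq R Z e (j K \o t)) => i /=; rewrite tE yE.
have t_ker x : H x = 0 -> t x = 0.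
  by move=> Hx0; apply: (inj_j K); rewrite jt ker_Hu ?linear0.
have t_comm x : str (T K) (t x) = v (H x) by rewrite -qE jt quE.
(* The problem is now a cell of stage K, hence solved at stage K+1. *)
have [_ _ _ /(_ (Cell presH t_ker t_comm))[w [wE qw]]] := stepP (T K).
exists (j K.+1 \o w); split=> x /=; first by rewrite wE /= j_inc jt.
exact: etrans (qE K.+1 (w x)) (qw x).
Qed.

End Factorization.

(** * Embeddings, covers and the equivalences *)

Section MainTheorem.
Variables (R : pzRingType) (n : nat).
Implicit Types A B C E F K M P Q X Y Z : lmodType R.

Lemma FPn_injective_embedding X :
  exists (B : lmodType R) (i : {linear X -> B}),
    injective i /\ FPn_injective n.+1 B.
Proof.
have [B [i [q [inj_i _ _ rl_q]]]] :=
  factorization_ex n (\0 : {linear X -> 'rV[R]_0}).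
exists B, i; split=> //.
(* The target R^0 is zero, so the kernel of [q] is all of [B]. *)
apply: (@right_lifting_ker _ _ B B _ idfun q) => // b.
split=> _; first by exists b.
by apply/rowP => -[].
Qed.

Lemma FPn_projective_cover P :
  exists (K Q : lmodType R) (i : {linear K -> Q}) (q : {linear Q -> P}),
    [/\ ses i q, FPn_injective n.+1 K & FPn_projective n.+1 Q].
Proof.
have [Q [z [q [_ _ ll_z rl_q]]]] :=
  factorization_ex n (\0 : {linear 'rV[R]_0 -> P}).
have [K [i [inj_i ker_q]]] := kernel_ex q.
exists K, Q, i, q; split.
- by split=> //; apply: (right_lifting_surj rl_q).
- exact: (right_lifting_ker rl_q inj_i).
move=> M inj_M E f p ses_fp.
(* Lifting the identity of [Q] along [p], starting from the zero module, gives a section. *)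
have [x|s [_ sK]] := ll_z M E Q f p inj_M ses_fp \0 idfun; last by exists s.
have -> : x = 0 by apply/rowP => -[].
by rewrite !linear0.
Qed.

Lemma n_pure_of_FPn_injective A B C (f : {linear A -> B}) (g : {linear B -> C}) :
  ses f g -> FPn_injective n.+1 A -> n_pure n.+1 f g.
Proof.
move=> ses_fg inj_A F presF; have [inj_f _ ker_g] := ses_fg; split.
- by move=> k1 k2 fk x; apply/inj_f/fk.
- move=> h; split=> [gh|[k kE] x]; last by apply/ker_g; exists (k x).
  by apply: (factor_inj inj_f) => x; apply/ker_g.
- by move=> h; apply: (Ext1_zero_lift h ses_fg); apply: inj_A.
Qed.

(** A map im H -> A extends to w : R^d -> B, and gw descends to coker H -> C. Purity lifts this to
    h' : coker H -> B; subtracting h' from [w] brings it into [A] without changing it on im H. *)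
Lemma FPn_injective_n_pure A B C (f : {linear A -> B}) (g : {linear B -> C}) :
  ses f g -> n_pure n.+1 f g -> FPn_injective n.+1 B -> FPn_injective n.+1 A.
Proof.
move=> [inj_f surj_g ker_g] pure_fg /FPn_injectiveP ext_B.
apply/FPn_injectiveP => e d H presH u ker_Hu.
have [x Hx0|w wE] := ext_B _ _ H presH (f \o u).
  by rewrite /= ker_Hu ?linear0.
have [F [p [surj_p ker_p]]] := cokernel_ex H.
have [_ /ker_p[x <-]|h hE] := factor_surj (h := g \o w) surj_p.
  by rewrite /= wE; apply/ker_g; exists (u x).
have [_ _ /(_ h)[h' h'E]] := pure_fg F (coker_fin_presented presH surj_p ker_p).
have [x|v vE] := factor_inj (g := w \- (h' \o p)) inj_f.
  by apply/ker_g; rewrite /= linearB h'E hE subrr.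
exists v => x; apply: inj_f; rewrite vE /=.
by have /ker_p -> : exists y, H y = H x; [exists x | rewrite linear0 subr0 wE].
Qed.

Lemma FPn_projective_lift P A B C (f : {linear A -> B}) (g : {linear B -> C}) :
  FPn_projective n.+1 P -> ses f g -> n_pure n.+1 f g ->
  FPn_injective n.+1 B ->
  forall h : {linear P -> C},
    exists h' : {linear P -> B}, forall x, g (h' x) = h x.
Proof.
move=> proj_P ses_fg pure_fg inj_B h.
apply: (Ext1_zero_lift h ses_fg); apply: proj_P.
exact: (FPn_injective_n_pure ses_fg pure_fg inj_B).
Qed.

Lemma FPn_projective_of_lift P :
  (forall A B C (f : {linear A -> B}) (g : {linear B -> C}),
      ses f g -> n_pure n.+1 f g -> FPn_injective n.+1 B ->
      forall h : {linear P -> C},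
        exists h' : {linear P -> B}, forall x, g (h' x) = h x) ->
  FPn_projective n.+1 P.
Proof.
move=> lift_P M inj_M X f g ses_fg; have [inj_f surj_g ker_g] := ses_fg.
have [B [i [inj_i inj_B]]] := FPn_injective_embedding X.
have [C [p [surj_p ker_p]]] := cokernel_ex (i \o f).
have ses_C : ses (i \o f) p by split=> // x y /inj_i/inj_f.
have [x|h hE] := factor_surj (h := p \o i) surj_g.
  by move=> /ker_g[m <-]; apply/ker_p; exists m.
have [h' h'E] := lift_P _ _ _ _ _ ses_C (n_pure_of_FPn_injective ses_C inj_M)
  inj_B h.
(* The difference i - h'g dies in C = B/M, so it lands in [M]; it agrees with [i] on [M], where [g]
   vanishes. *)
have [x|r rE] := factor_inj (f := i \o f) (g := i \- (h' \o g))
  (inj_comp inj_i inj_f).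
  by apply/ker_p; rewrite /= linearB h'E hE subrr.
apply: (section_of_retraction (r := r) ses_fg) => m.
apply/inj_f/inj_i; rewrite [LHS]rE /=.
by have /ker_g -> : exists a, f a = f m; [exists m | rewrite linear0 subr0].
Qed.

Lemma FPn_projective_of_splits P :
  (forall Q, FPn_projective n.+1 Q -> FPn_injective n.+1 Q) ->
  (forall A B (f : {linear A -> B}) (g : {linear B -> P}),
    ses f g -> n_pure n.+1 f g -> FPn_injective n.+1 B -> ses_splits g) ->
  FPn_projective n.+1 P.
Proof.
move=> proj_inj split_P M inj_M E f g ses_fg.
have [K [Q [i [q [ses_iq inj_K proj_Q]]]]] := FPn_projective_cover P.
have [s sK] := split_P _ _ _ _ ses_iq (n_pure_of_FPn_injective ses_iq inj_K)
  (proj_inj Q proj_Q).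
(* Lifting [q] to [E] and composing with the section [s] splits the given extension. *)
have [h hE] := Ext1_zero_lift q ses_fg (proj_Q M inj_M).
by exists (h \o s) => c /=; rewrite hE sK.
Qed.

End MainTheorem.

Theorem mainTheorem6 (R : pzRingType) (n : nat) (hn : (1 <= n)%N)
    (P : lmodType R) :
  (FPn_projective n P <->
   (forall (A B C : lmodType R) (f : {linear A -> B}) (g : {linear B -> C}),
      ses f g -> n_pure n f g -> FPn_injective n B ->
      forall h : {linear P -> C},
        exists h' : {linear P -> B}, forall x, g (h' x) = h x)) /\
  ((forall Q : lmodType R, FPn_projective n Q -> FPn_injective n Q) ->
   (FPn_projective n P <->
    (forall (A B : lmodType R) (f : {linear A -> B}) (g : {linear B -> P}),
       ses f g -> n_pure n f g -> FPn_injective n B -> ses_splits g))).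
Proof.
case: n hn => // n _; split=> [|proj_inj].
  split=> [proj_P A B C f g|]; last exact: FPn_projective_of_lift.
  exact: FPn_projective_lift.
split=> [proj_P A B f g ses_fg pure_fg inj_B|].
  (* A lift of the identity of [P] is a splitting. *)
  exact: (FPn_projective_lift proj_P ses_fg pure_fg inj_B idfun).
exact: FPn_projective_of_splits.
Qed.
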